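(* Let $k\in\mathbb{C}\setminus\{0\}$ and let $\mathfrak{g}=\mathfrak{gl}(1|1)$ be the complex Lie superalgebra with basis $E,N$ (even) and $\Psi^+,\Psi^-$ (odd), where $E$ is central, $[N,\Psi^\pm]=\pm\Psi^\pm$, $\{\Psi^-,\Psi^+\}=E$, and all other brackets of basis elements vanish. Let $$C=(2N-1)E+2\Psi^-\Psi^+ +\tfrac1k E^2\in U(\mathfrak{g}).$$ Then the automorphisms $\omega$ of $\mathfrak{g}$ satisfying $\omega(C)=C$ are exactly the members of the following two families, indexed by $\alpha\in\mathbb{C}$: $$\omega^{(0)}_\alpha:\quad E\mapsto E,\quad N\mapsto N,\quad \Psi^\pm\mapsto e^{\pm i\alpha}\Psi^\pm,$$ $$\omega^{(1)}_\alpha:\quad E\mapsto -E,\quad N\mapsto -N,\quad \Psi^\pm\mapsto \pm e^{\pm i\alpha}\Psi^\mp .$$ Moreover, every $\omega^{(0)}_\alpha$ is inner, namely $\omega^{(0)}_\alpha=\mathrm{Ad}_\alpha$; any two members of the second family are related by conjugation with some $\mathrm{Ad}_\beta$, $\beta\in\mathbb{C}$; and, up to composition with inner automorphisms $\mathrm{Ad}_\beta$, there are exactly two automorphisms of $\mathfrak{g}$ preserving $C$, represented by $\mathrm{id}$ and by $\omega^{(1)}_0$ (the latter is not of the form $\mathrm{Ad}_\beta$).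
   Context: An automorphism of a Lie superalgebra is an even (parity-preserving) $\mathbb{C}$-linear bijection preserving the super-bracket. It extends uniquely to an algebra automorphism of the universal enveloping superalgebra $U(\mathfrak{g})$, and $\omega(C)$ denotes the image of $C$ under this extension; in $U(\mathfrak{g})$ one has $\Psi^-\Psi^+ +\Psi^+\Psi^-=E$ and $(\Psi^\pm)^2=0$. For $\alpha\in\mathbb{C}$, $\mathrm{Ad}_\alpha=\exp(i\alpha\,\mathrm{ad}_N)$ denotes conjugation by $\exp(i\alpha N)$, i.e. $\mathrm{Ad}_\alpha(x)=e^{i\alpha N}xe^{-i\alpha N}$. ''Inner automorphism'' here means an automorphism of the form $\mathrm{Ad}_\alpha$ (since $E$ is central, these are all the inner automorphisms generated by even elements). *)

(* Defs.v *)
From HB Require Import structures.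
From mathcomp Require Import all_boot all_order all_algebra.
From mathcomp Require Import generic_quotient ring.
From mathcomp Require Import complex.
From mathcomp Require Import boolp classical_sets functions reals topology.
From mathcomp Require Import normedtype sequences.
Set Implicit Arguments.
Unset Strict Implicit.
Unset Printing Implicit Defensive.
Import Order.TTheory GRing.Theory Num.Theory.
Import numFieldNormedType.Exports.
Local Open Scope ring_scope.
Local Open Scope quotient_scope.
Local Open Scope classical_set_scope.

(* Parities are booleans: [false] is even and [true] is odd, so that the
   parity of a bracket is the exclusive or [p (+) q] and the Koszul sign of
   two homogeneous elements is [(-1) ^+ (p && q)]. *)
Record lieSuperalg (K : fieldType) (V : lmodType K) := LieSuperalg {
  part : bool -> {pred V};
  bracket : V -> V -> V;
  part_submod : forall p, submod_closed (part p);
  part_span : forall x, exists x0 x1,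
    [/\ x0 \in part false, x1 \in part true & x = x0 + x1];
  part_direct : forall x, x \in part false -> x \in part true -> x = 0;
  bracket_linearl : forall z, linear (bracket^~ z);
  bracket_linearr : forall z, linear (bracket z);
  bracket_part : forall p q x y, x \in part p -> y \in part q ->
    bracket x y \in part (p (+) q);
  bracket_skew : forall p q x y, x \in part p -> y \in part q ->
    bracket x y = - ((-1) ^+ (p && q) *: bracket y x);
  bracket_jacobi : forall p q x y z, x \in part p -> y \in part q ->
    bracket x (bracket y z) =
    bracket (bracket x y) z + (-1) ^+ (p && q) *: bracket y (bracket x z)
}.

Record is_lie_hom (K : fieldType) (V W : lmodType K)
    (g : lieSuperalg V) (h : lieSuperalg W) (w : V -> W) : Prop := IsLieHom {
  lie_hom_linear : linear w;
  lie_hom_part : forall p x, x \in part g p -> w x \in part h p;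
  lie_hom_bracket : {morph w : x y / bracket g x y >-> bracket h x y}
}.

Record is_lie_aut (K : fieldType) (V : lmodType K) (g : lieSuperalg V)
    (w : V -> V) : Prop := IsLieAut {
  lie_aut_hom : is_lie_hom g g w;
  lie_aut_bij : bijective w
}.

(* The universal enveloping superalgebra U(g) is [env g]; it is presented as the
   unital associative algebra generated by the vector space V, subject to linearity
   of the generators and to the supercommutation relations.  It is the
   quotient of formal expressions by the congruence [envrel]; [EScal a] stands
   for a times the unit, so 0 is [EScal 0] and - x is [EScal (- 1)] times x. *)
Section EnvelopingAlgebra.
Variables (K : fieldType) (V : lmodType K).

Inductive envexpr : Type :=
  | EGen of V
  | EScal of K
  | EAdd of envexpr & envexpr
  | EMul of envexpr & envexpr.

HB.instance Definition _ := gen_eqMixin envexpr.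
HB.instance Definition _ := gen_choiceMixin envexpr.

Variable g : lieSuperalg V.

Inductive envrel : envexpr -> envexpr -> Prop :=
  | ER_refl x : envrel x x
  | ER_sym x y : envrel x y -> envrel y x
  | ER_trans x y z : envrel x y -> envrel y z -> envrel x z
  | ER_add x x' y y' : envrel x x' -> envrel y y' ->
      envrel (EAdd x y) (EAdd x' y')
  | ER_mul x x' y y' : envrel x x' -> envrel y y' ->
      envrel (EMul x y) (EMul x' y')
  | ER_addA x y z : envrel (EAdd x (EAdd y z)) (EAdd (EAdd x y) z)
  | ER_addC x y : envrel (EAdd x y) (EAdd y x)
  | ER_add0 x : envrel (EAdd (EScal 0) x) x
  | ER_addN x : envrel (EAdd (EMul (EScal (- 1)) x) x) (EScal 0)
  | ER_mulA x y z : envrel (EMul x (EMul y z)) (EMul (EMul x y) z)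
  | ER_mul1l x : envrel (EMul (EScal 1) x) x
  | ER_mul1r x : envrel (EMul x (EScal 1)) x
  | ER_mulDl x y z :
      envrel (EMul (EAdd x y) z) (EAdd (EMul x z) (EMul y z))
  | ER_mulDr x y z :
      envrel (EMul x (EAdd y z)) (EAdd (EMul x y) (EMul x z))
  | ER_scalD a b : envrel (EScal (a + b)) (EAdd (EScal a) (EScal b))
  | ER_scalM a b : envrel (EScal (a * b)) (EMul (EScal a) (EScal b))
  | ER_scalC a x : envrel (EMul (EScal a) x) (EMul x (EScal a))
  | ER_gen_linear a u v :
      envrel (EGen (a *: u + v)) (EAdd (EMul (EScal a) (EGen u)) (EGen v))
  | ER_gen_bracket p q u v : u \in part g p -> v \in part g q ->
      envrel (EMul (EGen u) (EGen v))
             (EAdd (EMul (EScal ((-1) ^+ (p && q))) (EMul (EGen v) (EGen u)))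
                   (EGen (bracket g u v))).

Definition envrelb (x y : envexpr) : bool := `[< envrel x y >].

Lemma envrelb_equiv : equiv_class_of envrelb.
Proof.
split=> [x|x y|y x z]; rewrite /envrelb.
- exact/asboolP/ER_refl.
- by apply/asboolP/asboolP; exact: ER_sym.
- by move=> /asboolP h1 /asboolP h2; apply/asboolP/(ER_trans h1 h2).
Qed.

Canonical envrelb_equivRel := EquivRelPack envrelb_equiv.

Definition env : Type := {eq_quot envrelb_equivRel}.
HB.instance Definition _ := Choice.on env.

Definition env_pi (x : envexpr) : env := \pi_({eq_quot envrelb_equivRel}) x.
Definition env_repr (x : env) : envexpr :=
  repr (x : {eq_quot envrelb_equivRel}).

Lemma env_reprK : cancel env_repr env_pi.
Proof. exact: reprK. Qed.

Lemma env_piP x y : env_pi x = env_pi y <-> envrel x y.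
Proof.
split; first by move/eqmodP; rewrite /= /envrelb => /asboolP.
by move=> h; apply/eqmodP; rewrite /= /envrelb; exact/asboolP.
Qed.

Lemma env_repr_pi x : envrel (env_repr (env_pi x)) x.
Proof. by apply/env_piP; rewrite env_reprK. Qed.

Definition env_add (x y : env) : env := env_pi (EAdd (env_repr x) (env_repr y)).
Definition env_mul (x y : env) : env := env_pi (EMul (env_repr x) (env_repr y)).
Definition env_scal (a : K) : env := env_pi (EScal a).
Definition env_opp (x : env) : env := env_mul (env_scal (- 1)) x.
Definition env_scale (a : K) (x : env) : env := env_mul (env_scal a) x.

Lemma env_pi_add x y : env_add (env_pi x) (env_pi y) = env_pi (EAdd x y).
Proof. by apply/env_piP; apply: ER_add; exact: env_repr_pi. Qed.

Lemma env_pi_mul x y : env_mul (env_pi x) (env_pi y) = env_pi (EMul x y).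
Proof. by apply/env_piP; apply: ER_mul; exact: env_repr_pi. Qed.

Lemma env_ind (P : env -> Prop) : (forall x, P (env_pi x)) -> forall x, P x.
Proof. by move=> h x; rewrite -(env_reprK x). Qed.

Let envE := (env_pi_mul, env_pi_add).

Lemma env_addA : associative env_add.
Proof.
elim/env_ind=> x; elim/env_ind=> y; elim/env_ind=> z; rewrite !envE.
exact/env_piP/ER_addA.
Qed.
Lemma env_addC : commutative env_add.
Proof.
elim/env_ind=> x; elim/env_ind=> y; rewrite !envE; exact/env_piP/ER_addC.
Qed.
Lemma env_add0 : left_id (env_scal 0) env_add.
Proof. elim/env_ind=> x; rewrite !envE; exact/env_piP/ER_add0. Qed.
Lemma env_addN : left_inverse (env_scal 0) env_opp env_add.
Proof.
elim/env_ind=> x; rewrite /env_opp /env_scal env_pi_mul env_pi_add.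
exact/env_piP/ER_addN.
Qed.
Lemma env_mulA : associative env_mul.
Proof.
elim/env_ind=> x; elim/env_ind=> y; elim/env_ind=> z; rewrite !envE.
exact/env_piP/ER_mulA.
Qed.
Lemma env_mul1l : left_id (env_scal 1) env_mul.
Proof. elim/env_ind=> x; rewrite !envE; exact/env_piP/ER_mul1l. Qed.
Lemma env_mul1r : right_id (env_scal 1) env_mul.
Proof. elim/env_ind=> x; rewrite !envE; exact/env_piP/ER_mul1r. Qed.
Lemma env_mulDl : left_distributive env_mul env_add.
Proof.
elim/env_ind=> x; elim/env_ind=> y; elim/env_ind=> z; rewrite !envE.
exact/env_piP/ER_mulDl.
Qed.
Lemma env_mulDr : right_distributive env_mul env_add.
Proof.
elim/env_ind=> x; elim/env_ind=> y; elim/env_ind=> z; rewrite !envE.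
exact/env_piP/ER_mulDr.
Qed.
Lemma env_scalD : {morph env_scal : a b / a + b >-> env_add a b}.
Proof. move=> a b; rewrite !envE; exact/env_piP/ER_scalD. Qed.
Lemma env_scalM : {morph env_scal : a b / a * b >-> env_mul a b}.
Proof. move=> a b; rewrite !envE; exact/env_piP/ER_scalM. Qed.
Lemma env_scalC a x : env_mul (env_scal a) x = env_mul x (env_scal a).
Proof. elim/env_ind: x => x; rewrite !envE; exact/env_piP/ER_scalC. Qed.

Section Eval.
Variables (A : algType K) (f : V -> A).

Fixpoint enveval (x : envexpr) : A :=
  match x with
  | EGen v => f v
  | EScal a => a%:A
  | EAdd y z => enveval y + enveval z
  | EMul y z => enveval y * enveval z
  end.

Record is_env_compatible : Prop := IsEnvCompatible {
  env_compatible_linear : linear f;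
  env_compatible_bracket : forall p q u v,
    u \in part g p -> v \in part g q ->
    f u * f v = (-1) ^+ (p && q) *: (f v * f u) + f (bracket g u v)
}.

Lemma envevalP (hf : is_env_compatible) x y : envrel x y ->
  enveval x = enveval y.
Proof.
case: hf => flin fbr; elim=> //=.
- by move=> ? ? ? _ -> _ ->.
- by move=> ? ? ? ? _ -> _ ->.
- by move=> ? ? ? ? _ -> _ ->.
- by move=> ? ? ?; rewrite addrA.
- by move=> ? ?; rewrite addrC.
- by move=> ?; rewrite scale0r add0r.
- by move=> ?; rewrite scaleN1r mulN1r addNr scale0r.
- by move=> ? ? ?; rewrite mulrA.
- by move=> ?; rewrite scale1r mul1r.
- by move=> ?; rewrite scale1r mulr1.
- by move=> ? ? ?; rewrite mulrDl.
- by move=> ? ? ?; rewrite mulrDr.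
- by move=> ? ?; rewrite scalerDl.
- by move=> ? ?; rewrite mulr_algl scalerA.
- by move=> ? ?; rewrite mulr_algl mulr_algr.
- by move=> ? ? ?; rewrite flin mulr_algl.
- by move=> p q u v hu hv; rewrite mulr_algl; exact: fbr.
Qed.

End Eval.

(* The augmentation shows that the enveloping algebra is not zero. *)
Lemma env_1neq0 : env_scal 1 != env_scal 0.
Proof.
apply/eqP => /env_piP h.
have hz : @is_env_compatible K^o (fun=> 0).
  by split=> [a u v|p q u v _ _]; rewrite ?mul0r !scaler0 addr0.
have /eqP := envevalP hz h; rewrite /= scale1r scale0r; exact/negP/oner_neq0.
Qed.

HB.instance Definition _ :=
  GRing.isZmodule.Build env env_addA env_addC env_add0 env_addN.
HB.instance Definition _ := GRing.Zmodule_isNzRing.Build env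
  env_mulA env_mul1l env_mul1r env_mulDl env_mulDr env_1neq0.

Lemma env_scaleA a b x :
  env_scale a (env_scale b x) = env_scale (a * b) x.
Proof. by rewrite /env_scale env_mulA env_scalM. Qed.
Lemma env_scale1 : left_id 1 env_scale.
Proof. exact: env_mul1l. Qed.
Lemma env_scaleDr : right_distributive env_scale +%R.
Proof. by move=> a x y; exact: env_mulDr. Qed.
Lemma env_scaleDl x : {morph env_scale^~ x : a b / a + b}.
Proof. by move=> a b; rewrite /env_scale env_scalD; exact: env_mulDl. Qed.

HB.instance Definition _ := GRing.Zmodule_isLmodule.Build K env
  env_scaleA env_scale1 env_scaleDr env_scaleDl.

Lemma env_scaleAl (a : K) (x y : env) : a *: (x * y) = (a *: x) * y.
Proof. exact: env_mulA. Qed.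
HB.instance Definition _ :=
  GRing.LSemiModule_isLSemiAlgebra.Build K env env_scaleAl.

Lemma env_scaleAr (a : K) (x y : env) : a *: (x * y) = x * (a *: y).
Proof.
change (env_mul (env_scal a) (env_mul x y) =
        env_mul x (env_mul (env_scal a) y)).
by rewrite !env_mulA (env_scalC a x).
Qed.
HB.instance Definition _ :=
  GRing.LSemiAlgebra_isSemiAlgebra.Build K env env_scaleAr.

Definition env_in (v : V) : env := env_pi (EGen v).

Lemma env_piD x y : env_pi (EAdd x y) = env_pi x + env_pi y.
Proof. by rewrite -env_pi_add. Qed.
Lemma env_piM x y : env_pi (EMul x y) = env_pi x * env_pi y.
Proof. by rewrite -env_pi_mul. Qed.
Lemma env_piS a : env_pi (EScal a) = a%:A.
Proof. by rewrite -[RHS]/(env_mul _ _) env_mul1r. Qed.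

Lemma env_in_compatible : is_env_compatible env_in.
Proof.
split=> [a u v|p q u v hu hv]; rewrite /env_in.
  by rewrite ((env_piP _ _).2 (ER_gen_linear a u v)) env_piD env_piM env_piS
     mulr_algl.
by rewrite -env_piM ((env_piP _ _).2 (ER_gen_bracket hu hv)) env_piD !env_piM
   env_piS mulr_algl.
Qed.

Section UniversalProperty.
Variables (A : algType K) (f : V -> A) (hf : is_env_compatible f).

(* The argument [hf] is kept so that the algebra morphism structure below can
   be attached to the lift. *)
Definition env_lift of is_env_compatible f := fun x : env =>
  enveval f (env_repr x).

Local Notation lift := (env_lift hf).

Lemma env_lift_pi x : lift (env_pi x) = enveval f x.
Proof. exact/(envevalP hf)/env_repr_pi. Qed.

Lemma env_lift_in v : lift (env_in v) = f v.
Proof. exact: env_lift_pi. Qed.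

Lemma env_lift_linear : linear lift.
Proof.
move=> a; elim/env_ind=> x; elim/env_ind=> y.
by rewrite -mulr_algl -env_piS -env_piM -env_piD !env_lift_pi /= mulr_algl.
Qed.
HB.instance Definition _ :=
  GRing.isLinear.Build K env A *:%R lift env_lift_linear.

Lemma env_lift_monoid : monoid_morphism lift.
Proof.
split; first by rewrite -[1]/(env_pi (EScal 1)) env_lift_pi /= scale1r.
by elim/env_ind=> x; elim/env_ind=> y; rewrite -env_piM !env_lift_pi.
Qed.
HB.instance Definition _ :=
  GRing.isMonoidMorphism.Build env A lift env_lift_monoid.

Lemma env_lift_unique (phi : {lrmorphism env -> A}) :
  (forall v, phi (env_in v) = f v) -> phi =1 lift.
Proof.
move=> phif; elim/env_ind=> x; rewrite env_lift_pi.
elim: x => [v|a|x IHx y IHy|x IHx y IHy] /=.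
- exact: phif.
- by rewrite env_piS linearZ rmorph1.
- by rewrite env_piD rmorphD /= IHx IHy.
- by rewrite env_piM rmorphM /= IHx IHy.
Qed.

End UniversalProperty.
End EnvelopingAlgebra.

Lemma env_in_hom_compatible (K : fieldType) (V W : lmodType K)
    (g : lieSuperalg V) (h : lieSuperalg W) (w : V -> W) :
  is_lie_hom g h w -> is_env_compatible g (fun v => env_in h (w v)).
Proof.
case=> wlin wpart wbr; have [ilin ibr] := env_in_compatible h.
split=> [a u v|p q u v hu hv]; first by rewrite wlin ilin.
by rewrite wbr (ibr p q) ?wpart.
Qed.

(* The unique algebra morphism extending a morphism of Lie superalgebras. *)
Definition env_map (K : fieldType) (V W : lmodType K)
    (g : lieSuperalg V) (h : lieSuperalg W) (w : V -> W)
    (hw : is_lie_hom g h w) : {lrmorphism env g -> env h} :=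
  env_lift (env_in_hom_compatible hw).

Lemma env_map_in (K : fieldType) (V W : lmodType K)
    (g : lieSuperalg V) (h : lieSuperalg W) (w : V -> W)
    (hw : is_lie_hom g h w) v :
  env_map hw (env_in g v) = env_in h (w v).
Proof. exact: env_lift_in. Qed.

Lemma env_map_can (K : fieldType) (V W : lmodType K)
    (g : lieSuperalg V) (h : lieSuperalg W) (w : V -> W) (w' : W -> V)
    (hw : is_lie_hom g h w) (hw' : is_lie_hom h g w') :
  cancel w w' -> cancel (env_map hw) (env_map hw').
Proof.
move=> ww'; elim/env_ind=> x.
elim: x => [v|a|x IHx y IHy|x IHx y IHy].
- by rewrite -[env_pi _ _]/(env_in g v) !env_map_in ww'.
- by rewrite env_piS !linearZ /= !rmorph1.
- by rewrite env_piD !rmorphD /= IHx IHy.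
- by rewrite env_piM !rmorphM /= IHx IHy.
Qed.

Lemma is_lie_hom_inv (K : fieldType) (V : lmodType K) (g : lieSuperalg V)
    (w w' : V -> V) : is_lie_hom g g w -> cancel w w' -> cancel w' w ->
  is_lie_hom g g w'.
Proof.
move=> [wlin wpart wbr] ww' w'w; have winj := can_inj ww'; split.
- by move=> a u v; apply: winj; rewrite wlin !w'w.
- move=> p x xp; have [y0 [y1 [y0p y1p yE]]] := part_span g (w' x).
  have w0 : w 0 = 0 by rewrite -[0 in LHS](subrr 0) -scaleN1r addrC wlin
    scaleN1r addNr.
  have wE : x = w y0 + w y1.
    by rewrite -(w'w x) yE -[y0 in LHS]scale1r wlin scale1r.
  have sub q u v : u \in part g q -> v \in part g q -> u - v \in part g q.
    have [_ hq] := part_submod g q => hu hv.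
    by rewrite -scaleN1r addrC hq.
  have := wpart _ _ y0p; have := wpart _ _ y1p.
  case: p xp => xp wy1 wy0.
    have : w y0 = 0.
      apply: (part_direct wy0); rewrite (_ : w y0 = x - w y1) ?sub //.
      by rewrite wE addrK.
    by rewrite -w0 => /winj y00; rewrite yE y00 add0r.
  have : w y1 = 0.
    apply: (part_direct _ wy1); rewrite (_ : w y1 = x - w y0) ?sub //.
    by rewrite wE addrAC subrr add0r.
  by rewrite -w0 => /winj y10; rewrite yE y10 addr0.
- by move=> u v; apply: winj; rewrite wbr !w'w.
Qed.

Lemma env_map_bij (K : fieldType) (V : lmodType K) (g : lieSuperalg V)
    (w : V -> V) (hw : is_lie_hom g g w) :
  bijective w -> bijective (env_map hw).
Proof.
case=> w' ww' w'w; have hw' := is_lie_hom_inv hw ww' w'w.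
by exists (env_map hw'); exact: env_map_can.
Qed.

Lemma env_map_unique (K : fieldType) (V W : lmodType K)
    (g : lieSuperalg V) (h : lieSuperalg W) (w : V -> W)
    (hw : is_lie_hom g h w) (phi : {lrmorphism env g -> env h}) :
  (forall v, phi (env_in g v) = env_in h (w v)) -> phi =1 env_map hw.
Proof. exact: env_lift_unique. Qed.

Notation iE := (@Ordinal 4 0 isT).
Notation iN := (@Ordinal 4 1 isT).
Notation iPsip := (@Ordinal 4 2 isT).
Notation iPsim := (@Ordinal 4 3 isT).

(* The space underlying gl(1|1) is K^4 with ordered basis E, N, Psi+, Psi-. *)
Section Gl11.
Variable K : fieldType.
Implicit Types x y z : 'rV[K]_4.

Definition gE : 'rV[K]_4 := delta_mx 0 iE.
Definition gN : 'rV[K]_4 := delta_mx 0 iN.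
Definition gPsip : 'rV[K]_4 := delta_mx 0 iPsip.
Definition gPsim : 'rV[K]_4 := delta_mx 0 iPsim.

(* The linear map sending E, N, Psi+, Psi- to vE, vN, vp, vm. *)
Definition basis_map (vE vN vp vm : 'rV[K]_4) x : 'rV[K]_4 :=
  x 0 iE *: vE + x 0 iN *: vN + x 0 iPsip *: vp + x 0 iPsim *: vm.

Definition gl11_part (p : bool) : {pred 'rV[K]_4} :=
  fun x => if p then (x 0 iE == 0) && (x 0 iN == 0)
           else (x 0 iPsip == 0) && (x 0 iPsim == 0).

Definition gl11_bracket x y : 'rV[K]_4 :=
  (x 0 iPsip * y 0 iPsim + x 0 iPsim * y 0 iPsip) *: gE
  + (x 0 iN * y 0 iPsip - x 0 iPsip * y 0 iN) *: gPsip
  - (x 0 iN * y 0 iPsim - x 0 iPsim * y 0 iN) *: gPsim.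

Lemma gl11P x y : x 0 iE = y 0 iE -> x 0 iN = y 0 iN ->
  x 0 iPsip = y 0 iPsip -> x 0 iPsim = y 0 iPsim -> x = y.
Proof.
move=> h0 h1 h2 h3; apply/rowP => -[[|[|[|[|//]]]] hi];
  by rewrite (bool_irrelevance hi isT).
Qed.

Lemma gl11_bracketE x y :
  ((gl11_bracket x y 0 iE = (x 0 iPsip * y 0 iPsim + x 0 iPsim * y 0 iPsip)%R) *
   (gl11_bracket x y 0 iN = 0%R) *
   (gl11_bracket x y 0 iPsip = (x 0 iN * y 0 iPsip - x 0 iPsip * y 0 iN)%R) *
   (gl11_bracket x y 0 iPsim =
    (- (x 0 iN * y 0 iPsim - x 0 iPsim * y 0 iN))%R))%type.
Proof.
by do ![split]; rewrite /gl11_bracket !mxE /=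
  ?(mulr1, mulr0, addr0, add0r, oppr0, subr0).
Qed.

Lemma gl11_partP p x : x \in gl11_part p ->
  if p then x 0 iE = 0 /\ x 0 iN = 0 else x 0 iPsip = 0 /\ x 0 iPsim = 0.
Proof. by rewrite unfold_in /gl11_part; case: p => /andP[/eqP-> /eqP->]. Qed.

Lemma gl11_part_submod p : submod_closed (gl11_part p).
Proof.
split; first by rewrite unfold_in /gl11_part !mxE eqxx; case: p.
move=> a u v /gl11_partP hu /gl11_partP hv; rewrite unfold_in /gl11_part !mxE.
by case: p hu hv => -[-> ->] [-> ->]; rewrite mulr0 addr0 eqxx.
Qed.

Lemma gl11_part_span x : exists x0 x1,
  [/\ x0 \in gl11_part false, x1 \in gl11_part true & x = x0 + x1].
Proof.
exists (x 0 iE *: gE + x 0 iN *: gN), (x 0 iPsip *: gPsip + x 0 iPsim *: gPsim).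
split; rewrite ?unfold_in /gl11_part ?mxE /= ?(mulr0, addr0) ?eqxx //.
by apply: gl11P; rewrite !mxE /= !(mulr0, mulr1, addr0, add0r).
Qed.

Lemma gl11_part_direct x :
  x \in gl11_part false -> x \in gl11_part true -> x = 0.
Proof.
by move=> /gl11_partP[h2 h3] /gl11_partP[h0 h1]; apply: gl11P; rewrite mxE.
Qed.

Lemma gl11_linearl z : linear (gl11_bracket^~ z).
Proof. by move=> a u v; apply: gl11P; rewrite !(gl11_bracketE, mxE); ring. Qed.

Lemma gl11_linearr z : linear (gl11_bracket z).
Proof. by move=> a u v; apply: gl11P; rewrite !(gl11_bracketE, mxE); ring. Qed.

Lemma gl11_bracket_part p q x y : x \in gl11_part p -> y \in gl11_part q ->
  gl11_bracket x y \in gl11_part (p (+) q).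
Proof.
move=> /gl11_partP hx /gl11_partP hy.
rewrite unfold_in /gl11_part !gl11_bracketE.
by case: p q hx hy => -[] [hx1 hx2] [hy1 hy2] /=;
  rewrite ?(hx1, hx2, hy1, hy2) ?(mul0r, mulr0, subr0, addr0, oppr0) ?eqxx.
Qed.

Lemma gl11_skew p q x y : x \in gl11_part p -> y \in gl11_part q ->
  gl11_bracket x y = - ((-1) ^+ (p && q) *: gl11_bracket y x).
Proof.
move=> /gl11_partP hx /gl11_partP hy.
apply: gl11P; rewrite !(gl11_bracketE, mxE); case: p q hx hy => -[];
  move=> [hx1 hx2] [hy1 hy2]; rewrite ?(hx1, hx2, hy1, hy2) /=;
  by rewrite ?expr0 ?expr1; ring.
Qed.

Lemma gl11_jacobi p q x y z : x \in gl11_part p -> y \in gl11_part q ->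
  gl11_bracket x (gl11_bracket y z) =
  gl11_bracket (gl11_bracket x y) z
    + (-1) ^+ (p && q) *: gl11_bracket y (gl11_bracket x z).
Proof.
move=> /gl11_partP hx /gl11_partP hy.
apply: gl11P; rewrite !(gl11_bracketE, mxE); case: p q hx hy => -[];
  move=> [hx1 hx2] [hy1 hy2]; rewrite ?(hx1, hx2, hy1, hy2) /=;
  by rewrite ?expr0 ?expr1; ring.
Qed.

Definition gl11 : lieSuperalg 'rV[K]_4 :=
  LieSuperalg gl11_part_submod gl11_part_span gl11_part_direct
    gl11_linearl gl11_linearr gl11_bracket_part gl11_skew gl11_jacobi.

Definition casimir (k : K) : env gl11 :=
  let E := env_in gl11 gE in
  let N := env_in gl11 gN in
  let Psip := env_in gl11 gPsip in
  let Psim := env_in gl11 gPsim in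
  (2 * N - 1) * E + 2 * (Psim * Psip) + k^-1 *: E ^+ 2.

Definition casimir_aut (k : K) : set ('rV[K]_4 -> 'rV[K]_4) :=
  [set w | exists hw : is_lie_aut gl11 w,
    env_map (lie_aut_hom hw) (casimir k) = casimir k].

End Gl11.

Section Families.
Variable C : numClosedFieldType.
Local Notation V := 'rV[C]_4.

Definition expC (z : C) : C := limn (series (fun n => z ^+ n / n`!%:R)).

Definition exp_op (f : V -> V) : V -> V :=
  fun x => limn (series (fun n => n`!%:R^-1 *: iter n f x)).

Definition ad_gN : V -> V := bracket (gl11 C) (gN C).

(* Conjugation by exp(i alpha N): that exponential is not an element of the
   enveloping algebra, so conjugation by it is the operator exponential of
   i alpha ad_N. *)
Definition Ad (alpha : C) : V -> V := exp_op (fun x => ('i * alpha) *: ad_gN x).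

Definition omega0 (alpha : C) : V -> V :=
  basis_map (gE C) (gN C)
    (expC ('i * alpha) *: gPsip C) (expC (- ('i * alpha)) *: gPsim C).

Definition omega1 (alpha : C) : V -> V :=
  basis_map (- gE C) (- gN C)
    (expC ('i * alpha) *: gPsim C) (- (expC (- ('i * alpha)) *: gPsip C)).

(* [w'] is the conjugate of [w] by the bijection [f]. *)
Definition is_conjugate (f w w' : V -> V) : Prop :=
  exists f', [/\ cancel f f', cancel f' f & w' = f \o w \o f'].

(* The classes of [w] modulo composition with the maps [Ad beta] on either
   side. *)
Definition Ad_lclass (w : V -> V) : set (V -> V) :=
  range (fun beta => Ad beta \o w).
Definition Ad_rclass (w : V -> V) : set (V -> V) :=
  range (fun beta => w \o Ad beta).

End Families.

(* Main.v *)
Require Import Defs.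
From HB Require Import structures.
From mathcomp Require Import all_boot all_order all_algebra.
From mathcomp Require Import complex.
From mathcomp Require Import boolp classical_sets functions reals topology.
From mathcomp Require Import normedtype sequences.
From mathcomp Require Import ring exp trigo.
Import Order.TTheory GRing.Theory Num.Theory.
Import numFieldNormedType.Exports.
Local Open Scope ring_scope.
Local Open Scope classical_set_scope.

(* The brackets force an automorphism to send E to aE, N to N + cE or -N + cE,
   and Psi+, Psi- to multiples of themselves or of each other, respectively.
   Comparing the top diagonal entries of C and of its image in the
   two-dimensional modules with highest weight (e, n), for (e, n) = (1, 0) and
   (1, 1), gives c = 0 and a = 1 or a = -1 respectively, so that only one nonzero
   complex parameter is left.  Since the exponential is onto the nonzero complex
   numbers, these are the two families, and the maps Ad are exactly the first. *)

(** * The automorphisms preserving the Casimir element *)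

Lemma linear_at0 (K : pzRingType) (U V : lmodType K) (f : U -> V) :
  linear f -> f 0 = 0.
Proof.
move=> flin; have /eqP := flin 1 0 0; rewrite !scale1r addr0.
by rewrite -subr_eq0 opprD addNKr oppr_eq0 => /eqP.
Qed.

Lemma linear_scale (K : pzRingType) (U V : lmodType K) (f : U -> V) (a : K) x :
  linear f -> f (a *: x) = a *: f x.
Proof. by move=> flin; rewrite -[a *: x]addr0 flin linear_at0 // addr0. Qed.

(** * The two families with a nonzero scalar parameter *)

Section Diag.
Variable K : fieldType.
Local Notation V := 'rV[K]_4.
Implicit Types (c d : K) (x : V).

(** The scalar c stands for e^(i alpha), which separates the algebra from the analysis of the
    exponential. *)
Definition diag_aut c : V -> V :=
  basis_map (gE K) (gN K) (c *: gPsip K) (c^-1 *: gPsim K).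
Definition anti_aut c : V -> V :=
  basis_map (- gE K) (- gN K) (c *: gPsim K) (- (c^-1 *: gPsip K)).

Lemma diag_autE c x :
  ((diag_aut c x 0 iE = x 0 iE) * (diag_aut c x 0 iN = x 0 iN) *
   (diag_aut c x 0 iPsip = (c * x 0 iPsip)%R) *
   (diag_aut c x 0 iPsim = (c^-1 * x 0 iPsim)%R))%type.
Proof. by do ![split]; rewrite /diag_aut /basis_map !mxE /=; ring. Qed.

Lemma anti_autE c x :
  ((anti_aut c x 0 iE = (- x 0 iE)%R) * (anti_aut c x 0 iN = (- x 0 iN)%R) *
   (anti_aut c x 0 iPsip = (- (c^-1 * x 0 iPsim))%R) *
   (anti_aut c x 0 iPsim = (c * x 0 iPsip)%R))%type.
Proof. by do ![split]; rewrite /anti_aut /basis_map !mxE /=; ring. Qed.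

Lemma diag_aut1 : diag_aut 1 = id.
Proof.
by apply/funext => x; apply: gl11P; rewrite !diag_autE ?invr1 ?mul1r.
Qed.

Lemma diag_autM c d : diag_aut c \o diag_aut d = diag_aut (c * d).
Proof.
by apply/funext => x; apply: gl11P; rewrite /= !diag_autE // ?invfM mulrA.
Qed.

Lemma diag_anti_autM c d : diag_aut c \o anti_aut d = anti_aut (d / c).
Proof.
apply/funext => x; apply: gl11P; rewrite /= !(diag_autE, anti_autE) //.
  by rewrite invfM invrK mulrN mulrA (mulrC c).
by rewrite mulrA (mulrC d).
Qed.

Lemma anti_diag_autM c d : anti_aut d \o diag_aut c = anti_aut (d * c).
Proof.
apply/funext => x; apply: gl11P; rewrite /= !(diag_autE, anti_autE) //.
  by rewrite invfM mulrA.
by rewrite mulrA.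
Qed.

Lemma anti_autM c d : anti_aut c \o anti_aut d = diag_aut (- (d / c)).
Proof.
apply/funext => x; apply: gl11P; rewrite /= !(diag_autE, anti_autE) ?opprK //.
  by rewrite mulrA mulNr (mulrC d).
by rewrite mulrN mulrA invrN mulNr invfM invrK (mulrC c).
Qed.

Lemma diag_aut_hom c : c != 0 -> is_lie_hom (gl11 K) (gl11 K) (diag_aut c).
Proof.
move=> c0; split.
- by move=> a u v; apply: gl11P; rewrite !(diag_autE, mxE) //; ring.
- move=> p x /gl11_partP xp; rewrite unfold_in /= /gl11_part !diag_autE.
  by case: p xp => -[-> ->]; rewrite ?mulr0 eqxx.
- by move=> x y; apply: gl11P; rewrite /= !(gl11_bracketE, diag_autE) //; field.
Qed.

Lemma anti_aut_hom c : c != 0 -> is_lie_hom (gl11 K) (gl11 K) (anti_aut c).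
Proof.
move=> c0; split.
- by move=> a u v; apply: gl11P; rewrite !(anti_autE, mxE) //; ring.
- move=> p x /gl11_partP xp; rewrite unfold_in /= /gl11_part !anti_autE.
  by case: p xp => -[-> ->]; rewrite ?mulr0 ?oppr0 eqxx.
- by move=> x y; apply: gl11P; rewrite /= !(gl11_bracketE, anti_autE)
    ?oppr0 //; field.
Qed.

Lemma diag_aut_aut c : c != 0 -> is_lie_aut (gl11 K) (diag_aut c).
Proof.
move=> c0; split; first exact: diag_aut_hom.
exists (diag_aut c^-1) => x; rewrite -[LHS]/((_ \o _) _) diag_autM.
  by rewrite mulVf // diag_aut1.
by rewrite mulfV // diag_aut1.
Qed.

Lemma anti_aut_aut c : c != 0 -> is_lie_aut (gl11 K) (anti_aut c).
Proof.
move=> c0; split; first exact: anti_aut_hom.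
(* The square of [anti_aut c] is the parity map [diag_aut (-1)], so the inverse carries a sign. *)
exists (anti_aut (- c)) => x; rewrite -[LHS]/((_ \o _) _) anti_autM.
  by rewrite invrN mulrN opprK divff // diag_aut1.
by rewrite mulNr opprK divff // diag_aut1.
Qed.

(* The module with highest weight (e, n), in the basis v, v' with
   Psi+ v' = v and Psi- v = e v'. *)
Definition rep2 (e n : K) (x : V) : 'M[K]_2 :=
  \matrix_(i, j)
    if i == 0 then (if j == 0 then e * x 0 iE + n * x 0 iN else x 0 iPsip)
    else (if j == 0 then e * x 0 iPsim else e * x 0 iE + (n - 1) * x 0 iN).

(** Psi+ Psi- and Psi- Psi+ act by diag(e, 0) and diag(0, e), with sum e times the identity, and N
    has eigenvalues n and n - 1. The lift to U(g) turns an equation between elements of U(g) into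
    one between matrices. *)
Lemma rep2_compatible (e n : K) : is_env_compatible (gl11 K) (rep2 e n).
Proof.
split=> [a u v|p q u v /gl11_partP hu /gl11_partP hv].
  apply/matrixP => i j; rewrite !mxE.
  by case: ifP => _; case: ifP => _; ring.
apply/matrixP => i j.
rewrite !(mxE, big_ord_recl, big_ord0) /=.
case: p q hu hv => -[] [-> ->] [-> ->];
 by case: ifP => _; case: ifP => _; rewrite /= ?expr0 ?expr1; ring.
Qed.

(** The elements are arbitrary, so that this applies both to C and to the expression that an
    automorphism makes of it. *)
Lemma lrmorph_casimir_expr (U A : algType K) (phi : {lrmorphism U -> A})
    (n e m p : U) (a : K) :
  phi ((2 * n - 1) * e + 2 * (m * p) + a *: e ^+ 2) =
  (2 * phi n - 1) * phi e + 2 * (phi m * phi p) + a *: phi e ^+ 2.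
Proof.
rewrite 2!rmorphD /= linearZ_LR rmorphXn 3!rmorphM rmorphB rmorph1 /=.
by rewrite rmorphM !rmorph_nat.
Qed.

Lemma lrmorph_casimir (A : algType K) (phi : {lrmorphism env (gl11 K) -> A})
    (k : K) :
  let f := phi \o env_in (gl11 K) in
  phi (casimir k) = (2 * f (gN K) - 1) * f (gE K)
    + 2 * (f (gPsim K) * f (gPsip K)) + k^-1 *: f (gE K) ^+ 2.
Proof. exact: lrmorph_casimir_expr. Qed.

Lemma env_map_casimir (w : V -> V) (hw : is_lie_hom (gl11 K) (gl11 K) w) (k : K) :
  let f := env_in (gl11 K) \o w in
  env_map hw (casimir k) = (2 * f (gN K) - 1) * f (gE K)
    + 2 * (f (gPsim K) * f (gPsip K)) + k^-1 *: f (gE K) ^+ 2.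
Proof. by rewrite /= lrmorph_casimir /= !env_map_in. Qed.

Lemma lift_map_casimir (A : algType K) (f : V -> A)
  (hf : is_env_compatible (gl11 K) f) (w : V -> V)
  (hw : is_lie_hom (gl11 K) (gl11 K) w) (k : K) :
  env_lift hf (env_map hw (casimir k)) =
  (2 * f (w (gN K)) - 1) * f (w (gE K))
    + 2 * (f (w (gPsim K)) * f (w (gPsip K))) + k^-1 *: f (w (gE K)) ^+ 2.
Proof. by rewrite env_map_casimir lrmorph_casimir_expr /= !env_lift_in. Qed.

Lemma diag_aut_gens c :
  [/\ diag_aut c (gE K) = gE K, diag_aut c (gN K) = gN K,
      diag_aut c (gPsip K) = c *: gPsip K &
      diag_aut c (gPsim K) = c^-1 *: gPsim K].
Proof. by split; apply: gl11P; rewrite diag_autE !mxE /= ?mulr0 ?mulr1. Qed.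

Lemma anti_aut_gens c :
  [/\ anti_aut c (gE K) = - gE K, anti_aut c (gN K) = - gN K,
      anti_aut c (gPsip K) = c *: gPsim K &
      anti_aut c (gPsim K) = - (c^-1 *: gPsip K)].
Proof.
by split; apply: gl11P; rewrite anti_autE !mxE /= ?(mulr0, mulr1, oppr0).
Qed.

Lemma env_inZ a x : env_in (gl11 K) (a *: x) = a *: env_in (gl11 K) x.
Proof. by apply: linear_scale; case: (env_in_compatible (gl11 K)). Qed.

Lemma env_inN x : env_in (gl11 K) (- x) = - env_in (gl11 K) x.
Proof. by rewrite -scaleN1r env_inZ scaleN1r. Qed.

Lemma gl11_bracket_PsimPsip : gl11_bracket (gPsim K) (gPsip K) = gE K.
Proof. by apply: gl11P; rewrite gl11_bracketE !mxE /=; ring. Qed.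

Lemma gl11_bracket_NPsip : gl11_bracket (gN K) (gPsip K) = gPsip K.
Proof. by apply: gl11P; rewrite gl11_bracketE !mxE /=; ring. Qed.

Lemma gl11_bracket_NPsim : gl11_bracket (gN K) (gPsim K) = - gPsim K.
Proof. by apply: gl11P; rewrite gl11_bracketE !mxE /=; ring. Qed.

Lemma gl11_gen_part :
  [/\ gE K \in gl11_part false, gN K \in gl11_part false,
      gPsip K \in gl11_part true & gPsim K \in gl11_part true].
Proof. by split; rewrite unfold_in /gl11_part !mxE /= eqxx. Qed.

Lemma env_in_Psi :
  env_in (gl11 K) (gPsim K) * env_in (gl11 K) (gPsip K) +
  env_in (gl11 K) (gPsip K) * env_in (gl11 K) (gPsim K) = env_in (gl11 K) (gE K).
Proof.
have [_ br] := env_in_compatible (gl11 K).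
have [_ _ pp pm] := gl11_gen_part.
rewrite (br true true (gPsim K) (gPsip K)) //.
by rewrite /= expr1 scaleN1r addrAC addNr add0r gl11_bracket_PsimPsip.
Qed.

Lemma mulrZV (U : algType K) c (x y : U) : c != 0 ->
  (c^-1 *: x) * (c *: y) = x * y.
Proof. by move=> c0; rewrite -scalerAl -scalerAr scalerA mulVf // scale1r. Qed.

Lemma diag_aut_casimir c (k : K) : c != 0 -> casimir_aut k (diag_aut c).
Proof.
move=> c0; exists (diag_aut_aut c c0); rewrite env_map_casimir /=.
have [-> -> -> ->] := diag_aut_gens c.
by rewrite !env_inZ mulrZV.
Qed.

(** The first term becomes (2N + 1)E, a gain of 2E; the second becomes -2 Psi+ Psi- = 2 Psi- Psi+ -
    2E, a loss of 2E; the square does not see the sign of E. *)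
Lemma casimir_expr_anti (U : algType K) (n e m p : U) c (a : K) :
  c != 0 -> m * p + p * m = e ->
  (2 * - n - 1) * - e + 2 * (- (c^-1 *: p) * (c *: m)) + a *: (- e) ^+ 2 =
  (2 * n - 1) * e + 2 * (m * p) + a *: e ^+ 2.
Proof.
move=> c0 mpE; rewrite sqrrN; congr (_ + _).
rewrite [- _ * (_ *: _)]mulNr mulrZV // -mpE; set x := m * p; set y := p * m.
rewrite !mulrN -mulNr opprB opprK mulrDl mulrBl !mul1r !mulrDr.
rewrite !mulr_natl !mulr2n.
rewrite [x + y + _]addrC -!addrA; do 2 congr (_ + _).
by rewrite !opprD addNKr [- x - y]addrC -addrA addKr addrC.
Qed.

Lemma anti_aut_casimir c (k : K) : c != 0 -> casimir_aut k (anti_aut c).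
Proof.
move=> c0; exists (anti_aut_aut c c0); rewrite env_map_casimir /=.
have [-> -> -> ->] := anti_aut_gens c.
rewrite !env_inN !env_inZ.
exact: casimir_expr_anti c0 env_in_Psi.
Qed.

Lemma linear_basis_map (w : V -> V) : linear w ->
  w = basis_map (w (gE K)) (w (gN K)) (w (gPsip K)) (w (gPsim K)).
Proof.
move=> wlin; have w0 := linear_at0 _ _ _ _ wlin.
apply/funext => x; rewrite /basis_map -!addrA.
(* The final [+ 0] gives the last summand too the shape to which linearity applies. *)
rewrite [X in w X](_ : x = x 0 iE *: gE K + (x 0 iN *: gN K +
  (x 0 iPsip *: gPsip K + (x 0 iPsim *: gPsim K + 0)))).
  by rewrite !wlin w0 addr0.
by apply: gl11P; rewrite !mxE /=; ring.
Qed.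

(** Even elements act diagonally and odd ones antidiagonally, so only one product of coordinates of
    u and v reaches this entry. With u and v the images of Psi- and Psi+, that product detects an
    exchange of the two odd lines. *)
Lemma rep2_casimir (e n k : K) (x y u v : V) :
  u \in gl11_part true -> v \in gl11_part true ->
  x \in gl11_part false -> y \in gl11_part false ->
  ((2 * rep2 e n x - 1) * rep2 e n y + 2 * (rep2 e n u * rep2 e n v)
    + k^-1 *: rep2 e n y ^+ 2) 0 0 =
  (2 * (e * x 0 iE + n * x 0 iN) - 1) * (e * y 0 iE + n * y 0 iN)
    + 2 * (u 0 iPsip * (e * v 0 iPsim)) + k^-1 * (e * y 0 iE + n * y 0 iN) ^+ 2.
Proof.
move=> /gl11_partP[u0 u1] /gl11_partP[v0 v1] /gl11_partP[x0 x1].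
move=> /gl11_partP[y0 y1].
rewrite !mulr_natl !mulr2n !expr2 -!mulmxE -idmxE.
rewrite !(mxE, big_ord_recl, big_ord0) /= ?(u0,u1,v0,v1,x0,x1,y0,y1).
by ring.
Qed.

End Diag.

(** * Coordinates of an automorphism fixing the Casimir element *)

(** Here w(E) = a E and w(N) = c E + b N, while p2, p3 and m2, m3 are the Psi+, Psi- coordinates of
    w(Psi+) and w(Psi-). The brackets determine b and which odd coordinates vanish; the entries for
    (e, n) = (1, 0) and (1, 1) then determine a and c. *)
Lemma casimir_coords (K : numFieldType) (k a b c p2 p3 m2 m3 : K) :
  a = m2 * p3 + m3 * p2 -> p2 = b * p2 -> p3 = - (b * p3) ->
  - m2 = b * m2 -> - m3 = - (b * m3) -> a != 0 ->
  (forall e n, (2 * (e * c + n * b) - 1) * (e * a + n * 0)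
    + 2 * (m2 * (e * p3)) + k^-1 * (e * a + n * 0) ^+ 2 =
    (2 * n - 1) * e + k^-1 * e ^+ 2) ->
  p2 != 0 /\ [/\ a = 1, b = 1 & c = 0] /\ [/\ p3 = 0, m2 = 0 & m3 = p2^-1] \/
  p3 != 0 /\ [/\ a = -1, b = -1 & c = 0] /\ [/\ p2 = 0, m2 = - p3^-1 & m3 = 0].
Proof.
move=> aE pP pM mP mM a0 cas; have c10 := cas 1 0; have c11 := cas 1 1.
move: {cas} k^-1 c10 c11 => h /eqP; rewrite -subr_eq0 => /eqP c10.
move=> /eqP; rewrite -subr_eq0 => /eqP c11.
have two0 : 2 != 0 :> K by rewrite pnatr_eq0.
have half0 (x : K) : 2 * x = 0 -> x = 0.
  by move/eqP; rewrite mulf_eq0 (negPf two0) => /eqP.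
have [p20|p20] := eqVneq p2 0; [right|left].
  have p30 : p3 != 0 by apply: contra_neq a0 => p30; rewrite aE p20 p30; ring.
  have bN : b = -1.
    apply: (mulIf p30); rewrite mulN1r {2}pM opprK //.
  have m30 : m3 = 0.
    by apply: half0; rewrite mulr_natl mulr2n -{1}[m3]opprK mM bN; ring.
  have aM : a = m2 * p3 by rewrite aE m30; ring.
  have aN : a = -1.
    apply/eqP; rewrite -subr_eq0 opprK; apply/eqP/half0.
    (* Subtraction cancels c, the odd product and the square, leaving 2 - 2 b a = 0 with b = -1. *)
    have d := congr2 (fun x y => x - y) c10 c11.
    by apply: (etrans _ (etrans d (subrr 0))); rewrite bN; ring.
  have cN : c = 0.
    apply: half0.
    (* The factor [1 * p3] is the shape this product has in [c10], where e = 1. *)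
    have mp : m2 * (1 * p3) = -1 by rewrite mul1r -aM.
    by apply: (etrans _ (etrans (congr1 -%R c10) (oppr0 K)));
      rewrite mp aN bN; ring.
  split=> //; split=> //; split=> //.
  by apply: (mulIf p30); rewrite -aM aN mulNr mulVf.
have b1 : b = 1 by apply: (mulIf p20); rewrite mul1r -pP.
have p30 : p3 = 0.
  by apply: half0; rewrite mulr_natl mulr2n {1}pM b1; ring.
have m20 : m2 = 0.
  by apply: half0; rewrite mulr_natl mulr2n -{1}[m2]opprK mP b1; ring.
have aM : a = m3 * p2 by rewrite aE m20; ring.
have a1 : a = 1.
  apply/eqP; rewrite -subr_eq0; apply/eqP/half0.
  have d := congr2 (fun x y => x - y) c11 c10.
  by apply: (etrans _ (etrans d (subrr 0))); rewrite b1 m20; ring.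
(* With a = 1 the terms in h cancel, and [c10] reads 2 c = 0. *)
have c0 : c = 0.
  apply: half0.
  by apply: (etrans _ c10); rewrite m20 a1 b1; ring.
split=> //; split=> //; split=> //.
by apply: (mulIf p20); rewrite -aM a1 mulVf.
Qed.

Lemma casimir_autP (K : numFieldType) (k : K) (w : 'rV[K]_4 -> 'rV[K]_4) :
  casimir_aut k w ->
  (exists2 c, c != 0 & w = diag_aut K c) \/
  (exists2 c, c != 0 & w = anti_aut K c).
Proof.
move=> [[wh wb]] wk; have [wlin wpart wbr] := wh.
have [pE pN pp pm] := gl11_gen_part K.
(* The equation for C is pushed into the matrices of [rep2 e n] and read at the highest weight
   vector. *)
have cas e n : 
  (2 * (e * w (gN K) 0 iE + n * w (gN K) 0 iN) - 1) *
     (e * w (gE K) 0 iE + n * w (gE K) 0 iN) +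
   2 * (w (gPsim K) 0 iPsip * (e * w (gPsip K) 0 iPsim)) +
   k^-1 * (e * w (gE K) 0 iE + n * w (gE K) 0 iN) ^+ 2 = 
  (2 * n - 1) * e + k^-1 * e ^+ 2.
  have := congr1 (fun z => env_lift (rep2_compatible K e n) z 0 0) wk.
  rewrite lift_map_casimir lrmorph_casimir /= !env_lift_in.
  rewrite !rep2_casimir // ?(wpart false) ?(wpart true) //.
  by move=> ->; rewrite !mxE /=; ring.
have := linear_basis_map _ _ wlin.
have w0 := linear_at0 _ _ _ _ wlin.
have nE : w (gE K) != 0.
  apply/eqP; rewrite -{1}w0 => /(bij_inj wb).
  move=> /(congr1 (fun x : 'rV[K]_4 => x 0 iE)).
  by rewrite !mxE => /eqP; rewrite oner_eq0.
have hE := wbr (gPsim K) (gPsip K); have hp := wbr (gN K) (gPsip K).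
have hm := wbr (gN K) (gPsim K).
rewrite /= (gl11_bracket_PsimPsip K) in hE.
rewrite /= gl11_bracket_NPsip in hp.
rewrite /= gl11_bracket_NPsim in hm.
have wN : w (- gPsim K) = - w (gPsim K).
  by rewrite -scaleN1r linear_scale // scaleN1r.
rewrite wN in hm.
have /gl11_partP[E2 E3] := wpart false _ pE.
have /gl11_partP[N2 N3] := wpart false _ pN.
have /gl11_partP[p0 p1] := wpart true _ pp.
have /gl11_partP[m0 m1] := wpart true _ pm.
(* From here on only the four images matter, and w is replaced by the linear map they determine. *)
move: (w (gE K)) (w (gN K)) (w (gPsip K)) (w (gPsim K)) hE hp hm cas nE
  E2 E3 N2 N3 p0 p1 m0 m1.
move=> E N P M hE hp hm cas nE E2 E3 N2 N3 p0 p1 m0 m1 ->.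
have co (x y : 'rV[K]_4) i : x = y -> x 0 i = y 0 i by move->.
have aE := co _ _ iE hE; have aN := co _ _ iN hE.
have pP := co _ _ iPsip hp; have pM := co _ _ iPsim hp.
have mP := co _ _ iPsip hm; have mM := co _ _ iPsim hm.
rewrite !gl11_bracketE ?mxE ?N2 ?N3 in aE aN pP pM mP mM.
rewrite !mul0r !subr0 in pP pM mP mM.
(* The image of E is nonzero, even, and a bracket, hence without N coordinate; only its E coordinate
   is left. *)
have a0 : E 0 iE != 0.
  by apply: contra_neq nE => a0; apply: gl11P; rewrite ?mxE ?a0 ?aN.
have cas' e n := cas e n; rewrite aN in cas'.
have [[p2 [[a1 b1 c0] [p3 m2 m3]]]|[p3 [[a1 b1 c0] [p2 m2 m3]]]] :=
    casimir_coords _ _ _ _ _ _ _ _ _ aE pP pM mP mM a0 cas'.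
  left; exists (P 0 iPsip) => //; apply/funext => x.
  by apply: gl11P; rewrite diag_autE /basis_map !mxE
    ?(E2, E3, N2, N3, p0, p1, m0, m1, a1, b1, c0, p3, m2, m3, aN); ring.
right; exists (P 0 iPsim) => //; apply/funext => x.
by apply: gl11P; rewrite anti_autE /basis_map !mxE
  ?(E2, E3, N2, N3, p0, p1, m0, m1, a1, b1, c0, p2, m2, m3, aN); ring.
Qed.

(** * The two families as cosets of the diagonal automorphisms *)

Definition diag_auts (K : fieldType) : set ('rV[K]_4 -> 'rV[K]_4) :=
  [set diag_aut K c | c in [set c | c != 0]].
Definition anti_auts (K : fieldType) : set ('rV[K]_4 -> 'rV[K]_4) :=
  [set anti_aut K c | c in [set c | c != 0]].

Lemma diag_auts1 (K : fieldType) : diag_auts K (diag_aut K 1).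
Proof. by exists 1; first exact: oner_neq0. Qed.

Lemma anti_auts1 (K : fieldType) : anti_auts K (anti_aut K 1).
Proof. by exists 1; first exact: oner_neq0. Qed.

(** The class map is arbitrary, so the same count serves composition on the left and on the
    right. *)
Lemma image_diag_anti_auts (K : fieldType) (T : Type)
    (cl : ('rV[K]_4 -> 'rV[K]_4) -> T) (a b : T) :
  (forall c, c != 0 -> cl (diag_aut K c) = a) ->
  (forall c, c != 0 -> cl (anti_aut K c) = b) ->
  [set cl w | w in diag_auts K `|` anti_auts K] = [set a; b].
Proof.
move=> cla clb; apply/seteqP; split=> [_ [w wk <-]|_ [->|->]].
- by case: wk => -[c c0 <-]; [left; exact: cla|right; exact: clb].
- exists (diag_aut K 1); first by left; exact: diag_auts1.
  by apply: cla; exact: oner_neq0.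
- exists (anti_aut K 1); first by right; exact: anti_auts1.
  by apply: clb; exact: oner_neq0.
Qed.

Lemma diag_aut_neq_anti_aut (K : numFieldType) (c d : K) :
  diag_aut _ c <> anti_aut _ d.
Proof.
move=> /(congr1 (fun w : _ -> 'rV[K]_4 => w (gE K) 0 iE)).
rewrite diag_autE anti_autE mxE /=.
by move/eqP; rewrite -subr_eq0 opprK -mulr2n pnatr_eq0.
Qed.

Lemma diag_auts_neq_anti_auts (K : numFieldType) : diag_auts K <> anti_auts K.
Proof.
move=> /seteqP[sub _]; have [c _ /esym] := sub _ (diag_auts1 K).
exact: diag_aut_neq_anti_aut.
Qed.

Section Classes.
Variables (K : fieldType) (d : K).
Hypothesis d0 : d != 0.

Lemma diag_auts_comp_diag :
  [set f \o diag_aut K d | f in diag_auts K] = diag_auts K.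
Proof.
apply/seteqP; split=> [_ [_ [c c0 <-] <-]|_ [c c0 <-]].
  by exists (c * d); [rewrite /= mulf_neq0|rewrite diag_autM].
exists (diag_aut K (c / d)); last by rewrite diag_autM divfK.
by exists (c / d); rewrite // /= mulf_neq0 ?invr_eq0.
Qed.

Lemma diag_comp_diag_auts :
  [set diag_aut K d \o f | f in diag_auts K] = diag_auts K.
Proof.
rewrite -[RHS]diag_auts_comp_diag; apply/seteqP.
by split=> _ [_ [c c0 <-] <-]; exists (diag_aut K c);
  rewrite ?diag_autM 1?mulrC //; exists c.
Qed.

Lemma diag_auts_comp_anti :
  [set f \o anti_aut K d | f in diag_auts K] = anti_auts K.
Proof.
apply/seteqP; split=> [_ [_ [c c0 <-] <-]|_ [c c0 <-]].
  by exists (d / c); [rewrite /= mulf_neq0 ?invr_eq0|rewrite diag_anti_autM].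
exists (diag_aut K (d / c)).
  by exists (d / c); rewrite // /= mulf_neq0 ?invr_eq0.
by rewrite diag_anti_autM invf_div mulrC divfK.
Qed.

Lemma anti_comp_diag_auts :
  [set anti_aut K d \o f | f in diag_auts K] = anti_auts K.
Proof.
apply/seteqP; split=> [_ [_ [c c0 <-] <-]|_ [c c0 <-]].
  by exists (d * c); [rewrite /= mulf_neq0|rewrite anti_diag_autM].
exists (diag_aut K (c / d)).
  by exists (c / d); rewrite // /= mulf_neq0 ?invr_eq0.
by rewrite anti_diag_autM mulrC divfK.
Qed.

End Classes.

(** Conjugation by [diag_aut b] turns the parameter c into c / b^2, so b is a square root of c /
    d. *)
Lemma anti_aut_conjugate (K : numClosedFieldType) (c d : K) : c != 0 -> d != 0 ->
  exists2 b, b != 0 & is_conjugate (diag_aut _ b) (anti_aut _ c) (anti_aut _ d).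
Proof.
move=> c0 d0; pose b := sqrtC (c / d).
have b2 : b ^+ 2 = c / d by rewrite sqrtCK.
have b0 : b != 0 by rewrite sqrtC_eq0 mulf_neq0 ?invr_eq0.
exists b => //; exists (diag_aut _ b^-1); split=> [x|x|].
- by rewrite -[LHS]/((_ \o _) _) diag_autM mulVf // diag_aut1.
- by rewrite -[LHS]/((_ \o _) _) diag_autM mulfV // diag_aut1.
- rewrite diag_anti_autM anti_diag_autM; congr anti_aut.
  by rewrite -mulrA -invfM -expr2 b2 invf_div mulrC divfK.
Qed.

(** * The complex exponential *)

Lemma exp_coeffD (F : numFieldType) (z w : F) (n : nat) :
  (z + w) ^+ n / n`!%:R =
  \sum_(i < n.+1) (z ^+ i / i`!%:R) * (w ^+ (n - i) / (n - i)`!%:R).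
Proof.
rewrite addrC exprDn mulr_suml; apply: eq_bigr => i _.
have le_in : (i <= n)%N by rewrite -ltnS.
have f0 m : m`!%:R != 0 :> F by rewrite pnatr_eq0 -lt0n fact_gt0.
rewrite -(bin_fact le_in) !natrM -mulr_natr.
have b0 : 'C(n, i)%:R != 0 :> F by rewrite pnatr_eq0 -lt0n bin_gt0.
by field; rewrite !f0 b0.
Qed.

(** The product of partial sums runs over the square i, j < N, and the binomial theorem makes the
    partial sum at z + w run over the triangle i + j < N; the rest of the square remains. *)
Lemma sum_exp_coeffM (F : numFieldType) (z w : F) (N : nat) :
  (\sum_(i < N) z ^+ i / i`!%:R) * (\sum_(j < N) w ^+ j / j`!%:R)
    - \sum_(n < N) (z + w) ^+ n / n`!%:R =
  \sum_(i < N) \sum_(j < N | (N <= i + j)%N)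
    (z ^+ i / i`!%:R) * (w ^+ j / j`!%:R).
Proof.
set t := fun i j : nat => (z ^+ i / i`!%:R) * (w ^+ j / j`!%:R).
have -> : \sum_(n < N) (z + w) ^+ n / n`!%:R =
          \sum_(i < N) \sum_(j < N | (i + j < N)%N) t i j.
  (* The triangle is sliced into its antidiagonals i + j = n. *)
  transitivity (\sum_(n < N) \sum_(i < N) \sum_(j < N | (i + j == n)%N) t i j).
    apply: eq_bigr => n _; rewrite exp_coeffD.
    rewrite (big_ord_widen N (fun i => t i (n - i)%N)) // big_mkcond /=.
    apply: eq_bigr => i _; case: ifPn => [|]; rewrite ltnS => le_in.
      have lt_N : (n - i < N)%N by rewrite (leq_ltn_trans (leq_subr _ _)).
      rewrite (big_pred1 (Ordinal lt_N)) // => j /=.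
      by rewrite -val_eqE /= -(eqn_add2l i j) subnKC.
    rewrite big1 // => j /eqP ijn; case/negP: le_in.
    by rewrite -ijn leq_addr.
  rewrite exchange_big; apply: eq_bigr => i _.
  rewrite (exchange_big_dep xpredT) //= [RHS]big_mkcond.
  apply: eq_bigr => j _; case: ifPn => ij.
    by rewrite (big_pred1 (Ordinal ij)) // => n; rewrite -val_eqE /= eq_sym.
  rewrite big1 // => n /eqP ijn; case/negP: ij; by rewrite ijn.
rewrite mulr_suml -sumrB; apply: eq_bigr => i _; rewrite mulr_sumr.
rewrite (bigID (fun j : 'I_N => (i + j < N)%N)) /= addrAC subrr add0r.
by apply: eq_bigl => j; rewrite -leqNgt.
Qed.

(* By sum_exp_coeffM the defect has nonnegative coefficients, so it is dominated
   by the same defect at the absolute values. *)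
Lemma le_series_exp_coeffM (F : numFieldType) (z w : F) (N : nat) :
  let S (x : F) := series (fun n => x ^+ n / n`!%:R) in
  `|S z N * S w N - S (z + w) N| <= S `|z| N * S `|w| N - S (`|z| + `|w|) N.
Proof.
rewrite /series /= !big_mkord.
rewrite !sum_exp_coeffM; apply: (le_trans (ler_norm_sum _ _ _)).
apply: ler_sum => i _; apply: (le_trans (ler_norm_sum _ _ _)).
by apply: ler_sum => j _; rewrite !normrM !normfV !normrX !normr_nat.
Qed.

Lemma cvg0_le_norm (F : numFieldType) (u v : F^nat) :
  (forall n, `|u n| <= v n) -> v @ \oo --> (0 : F) -> u @ \oo --> (0 : F).
Proof.
move=> uv /cvgrPdist_lt v0; apply/cvgrPdist_lt => e e0.
apply: filterS (v0 e e0) => n; rewrite !sub0r !normrN; apply: le_lt_trans.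
by rewrite [leRHS]ger0_norm // (le_trans _ (uv n)).
Qed.

Section ComplexExponential.
Variable R : realType.
Local Notation C := (R[i] : numClosedFieldType).
Local Notation S z := (series (fun n => z ^+ n / n`!%:R : C)).

Lemma cvg_real_complex (u : R^nat) (l : R) :
  u @ \oo --> l -> (fun n => (u n)%:C%C : C) @ \oo --> (l%:C%C : C).
Proof.
move=> ul; apply/cvgrPdist_lt => e e0.
(* A positive element of R[i] is real, so the radius comes from a positive real number. *)
have e_real : e \is Num.real by rewrite gtr0_real.
have eE := RRe_real e_real.
have Re0 : 0 < complex.Re e by rewrite -ltcR eE.
move/cvgrPdist_lt : ul => /(_ _ Re0); apply: filterS => n /=.
rewrite -eE -(rmorphB (real_complex R)) normc_def /= expr0n addr0 sqrtr_sqr.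
by rewrite ltcR.
Qed.

Lemma cvg_complex (u v : R^nat) (a b : R) :
  u @ \oo --> a -> v @ \oo --> b ->
  (fun n => (u n +i* v n)%C : C) @ \oo --> ((a +i* b)%C : C).
Proof.
move=> ua vb; rewrite [X in _ --> X]complexE /=.
have -> : (fun n => (u n +i* v n)%C : C) =
          (fun n => ((u n)%:C)%C + 'i%C * ((v n)%:C)%C : C).
  by apply/funext => n; rewrite [LHS]complexE.
apply: (@cvgD C C); first exact: cvg_real_complex.
by apply: (@cvgM C); [exact: cvg_cst|exact: cvg_real_complex].
Qed.

Lemma sum_complex (n : nat) (u v : nat -> R) :
  \sum_(0 <= i < n) (u i +i* v i)%C =
  ((\sum_(0 <= i < n) u i) +i* (\sum_(0 <= i < n) v i))%C.
Proof.
elim: n => [|n IHn]; first by rewrite !big_nil.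
by rewrite !big_nat_recr //= IHn.
Qed.

Lemma cvg_exp_real (x : R) : S (x%:C)%C @ \oo --> ((expR x)%:C%C : C).
Proof.
have -> : S (x%:C)%C = (fun n => ((series (exp_coeff x) n)%:C)%C : C).
  apply/funext => n; rewrite /series /= rmorph_sum; apply: eq_bigr => i _.
  by rewrite /exp_coeff /= rmorphM rmorphXn fmorphV rmorph_nat.
by apply: cvg_real_complex; exact: is_cvg_series_exp_coeff.
Qed.

Lemma cvg_exp_imag (y : R) :
  S (0 +i* y)%C @ \oo --> ((cos y +i* sin y)%C : C).
Proof.
have -> : S (0 +i* y)%C = (fun n => (series (cos_coeff y) n +i*
                                      series (sin_coeff y) n)%C : C).
  apply/funext => n; rewrite /series /= -sum_complex; apply: eq_bigr => i _.
  have -> : (0 +i* y)%C = 'i%C * (y%:C)%C by simpc.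
  have -> : i`!%:R^-1 = (i`!%:R^-1)%:C%C :> C by rewrite fmorphV rmorph_nat.
  rewrite exprMn -(rmorphXn (real_complex R)) -mulrA -rmorphM.
  rewrite /cos_coeff /sin_coeff /= -!mulrA; set q := _ / _.
  (* Even powers of the imaginary unit are real and give the cosine coefficients; odd ones are
     imaginary and give the sine coefficients. *)
  have -> : 'i%C ^+ i = (((~~ odd i)%:R * (-1) ^+ i./2) +i*
                         ((odd i)%:R * (-1) ^+ i.-1./2))%C :> R[i].
    rewrite -[in LHS](odd_double_half i) exprD -mul2n exprM sqr_i.
    rewrite -(rmorphN1 (real_complex R)) -rmorphXn.
    have [io|io] := boolP (odd i); last by simpc.
    have -> : i.-1./2 = i./2.
      by rewrite -[in LHS](odd_double_half i) io /= doubleK.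
    by simpc.
  by simpc; rewrite /q !mulrA.
by apply: cvg_complex; [rewrite unlock; exact: is_cvg_series_cos_coeff
  | rewrite unlock; exact: is_cvg_series_sin_coeff].
Qed.

(** Euler's formula as a closed form for the limit of the series; the addition law and surjectivity
    follow from real analysis. *)
Definition cexp (z : R[i]) : R[i] :=
  (expR (complex.Re z))%:C%C * (cos (complex.Im z) +i* sin (complex.Im z))%C.

(** For z = x + iy the real and imaginary series converge separately. Their product differs from the
    series at z by the defect [D], dominated by the defect at |x| and |y|, which tends to e^|x|
    e^|y| - e^(|x| + |y|) = 0. *)
Lemma cvg_exp (z : R[i]) : S z @ \oo --> (cexp z : C).
Proof.
case: z => x y; set z := (x +i* y)%C.
pose a : C := x%:C%C; pose b : C := (0 +i* y)%C.
have zE : z = a + b by rewrite /z /a /b; simpc.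
pose D (a b : C) := fun n => S a n * S b n - S (a + b) n.
have D0 : D a b @ \oo --> (0 : C).
  have na : `|a| = `|x|%:C%C by rewrite /a normc_def /= expr0n addr0 sqrtr_sqr.
  have nb : `|b| = `|y|%:C%C by rewrite /b normc_def /= expr0n add0r sqrtr_sqr.
  have B0 : D `|a| `|b| @ \oo --> (0 : C).
    rewrite -(subrr ((expR `|x|)%:C%C * (expR `|y|)%:C%C)) na nb.
    apply: (@cvgB C C); first by apply: (@cvgM C); exact: cvg_exp_real.
    rewrite -rmorphM -expRD -rmorphD; exact: cvg_exp_real.
  apply: (@cvg0_le_norm C _ (D `|a| `|b|)) => // n.
  exact: (@le_series_exp_coeffM C a b n).
have -> : S z = (fun n => S a n * S b n - D a b n).
  by apply/funext => n; rewrite /D subKr zE.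
rewrite -[cexp z]subr0; apply: (@cvgB C C _ _ _ _ _ _ _ _ D0).
by apply: (@cvgM C); [exact: cvg_exp_real|exact: cvg_exp_imag].
Qed.

Lemma cexpD (z w : R[i]) : cexp (z + w) = cexp z * cexp w.
Proof.
case: z w => [x y] [x' y']; rewrite /cexp /= expRD cosD sinD.
by apply/eqP; rewrite eq_complex /=; apply/andP; split; apply/eqP; ring.
Qed.

Lemma cexp_surj (c : R[i]) : c != 0 -> exists z, cexp z = c.
Proof.
case: c => a b ab0; set r := Num.sqrt (a ^+ 2 + b ^+ 2).
have r_gt0 : 0 < r.
  by have := ab0; rewrite -normr_gt0 normc_def /= ltcR.
have r2 : r ^+ 2 = a ^+ 2 + b ^+ 2 by rewrite sqr_sqrtr // addr_ge0 ?sqr_ge0.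
have ar1 : (a / r) ^+ 2 + (b / r) ^+ 2 = 1.
  by rewrite !exprMn -mulrDl -r2 exprVn divff // expf_neq0 // gt_eqF.
have ar : -1 <= a / r <= 1.
  rewrite -ler_norml -(@ler_pXn2r _ 2) ?nnegrE // expr1n real_normK ?num_real //.
  by rewrite -ar1 lerDl sqr_ge0.
(* The arccosine of a / r has the right cosine, and the sign of b / r decides between it and its
   opposite. *)
have [t [ct st]] : exists t, cos t = a / r /\ sin t = b / r.
  have sE : sin (acos (a / r)) = `|b / r|.
    rewrite sin_acos // -sqrtr_sqr -ar1; congr Num.sqrt.
    by rewrite addrAC subrr add0r.
  have [b0|b0] := leP 0 (b / r).
    by exists (acos (a / r)); rewrite acosK ?sE ?ger0_norm.
  by exists (- acos (a / r)); rewrite cosN sinN acosK ?sE ?ltr0_norm ?opprK.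
exists (ln r +i* t)%C; rewrite /cexp /= ct st lnK ?posrE //.
by simpc; rewrite !(mulrC r) !divfK // gt_eqF.
Qed.

End ComplexExponential.

(** * Inner automorphisms *)

(** There are finitely many entries, so their eventual bounds hold simultaneously. *)
Lemma cvg_mx (K : numFieldType) (m n : nat) (u : nat -> 'M[K]_(m, n))
    (l : 'M[K]_(m, n)) :
  (forall i j, (fun N => u N i j) @ \oo --> l i j) -> u @ \oo --> l.
Proof.
move=> ul; apply/cvg_ballP => e e0.
suff h : \forall N \near \oo, forall i j, ball (l i j) e (u N i j).
  by apply: filterS h => N h; split.
apply: filter_forall => i; apply: filter_forall => j.
by have /cvg_ballP := ul i j; apply.
Qed.

(** Iterating f multiplies coordinate i by powers of t i, so each coordinate of the operator series
    is a scalar exponential series times that of x. *)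
Lemma exp_op_diag (C : numClosedFieldType) (f : 'rV[C]_4 -> 'rV[C]_4)
    (t s : 'I_4 -> C) (x : 'rV[C]_4) :
  (forall y i, f y 0 i = t i * y 0 i) ->
  (forall i, series (fun n => t i ^+ n / n`!%:R) @ \oo --> s i) ->
  forall i, exp_op f x 0 i = s i * x 0 i.
Proof.
move=> ft ts i; suff -> : exp_op f x = \row_j (s j * x 0 j) by rewrite mxE.
apply: cvg_lim; first exact: norm_hausdorff.
apply: cvg_mx => i' j; rewrite !mxE (ord1 i').
have -> : (fun N => series (fun n => n`!%:R^-1 *: iter n f x) N 0 j) =
          (fun N => series (fun n => t j ^+ n / n`!%:R) N * x 0 j).
  apply/funext => N; rewrite /series /= summxE mulr_suml.
  apply: eq_bigr => n _; rewrite mxE [t j ^+ n / _]mulrC -mulrA.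
  congr (_ * _); elim: n => [|n IHn]; first by rewrite mul1r.
  by rewrite iterS ft IHn exprS mulrA.
by apply: cvgM (ts j) _; exact: cvg_cst.
Qed.

Lemma scale_ad_gN (C : numClosedFieldType) (z : C) (y : 'rV[C]_4) (i : 'I_4) :
  (z *: ad_gN y) 0 i = [:: 0; 0; z; - z]`_i * y 0 i.
Proof.
have -> : (z *: ad_gN y) 0 i = z * gl11_bracket (gN C) y 0 i by rewrite mxE.
case: i => -[|[|[|[|//]]]] hi; rewrite (bool_irrelevance hi isT);
  rewrite gl11_bracketE ?mxE /=; ring.
Qed.

(** * Classes modulo inner automorphisms, for an abstract exponential *)

Section Inner.
Variables (C : numClosedFieldType) (e : C -> C).
Hypothesis cvg_e : forall z, series (fun n => z ^+ n / n`!%:R) @ \oo --> e z.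
Hypothesis eD : forall z w, e (z + w) = e z * e w.
Hypothesis e_surj : forall c, c != 0 -> exists z, e z = c.

(** Surjectivity provides w with e w = 1, and additivity is applied to w + 0. *)
Lemma exp0 : e 0 = 1.
Proof.
have [w w1] := e_surj 1 (oner_neq0 C).
by have := eD w 0; rewrite addr0 w1 mul1r.
Qed.

Lemma exp_neq0 z : e z != 0.
Proof.
apply/eqP => ez0; have := oner_neq0 C.
by rewrite -exp0 -[X in e X](subrr z) eD ez0 mul0r eqxx.
Qed.

Lemma expN z : e (- z) = (e z)^-1.
Proof.
by apply: (mulfI (exp_neq0 z)); rewrite divff ?exp_neq0 // -eD subrr exp0.
Qed.

Lemma expCE z : expC z = e z.
Proof. by apply: cvg_lim; [exact: norm_hausdorff|exact: cvg_e]. Qed.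

(** In the basis E, N, Psi+, Psi- the operator ad_N is diagonal with eigenvalues 0, 0, 1, -1, so its
    exponential is diagonal too. *)
Lemma AdE beta : Ad beta = diag_aut C (e ('i * beta)).
Proof.
set z := 'i * beta; apply/funext => x.
pose t (i : 'I_4) : C := [:: 0; 0; z; - z]`_i.
have adE := exp_op_diag _ _ t (fun i => e (t i)) x (scale_ad_gN _ z)
  (fun i => cvg_e (t i)).
by apply: gl11P; rewrite diag_autE /Ad adE -?expN /t /= ?exp0 ?mul1r.
Qed.

Lemma omega0E alpha : omega0 alpha = diag_aut C (e ('i * alpha)).
Proof. by rewrite /omega0 /diag_aut !expCE expN. Qed.

Lemma omega1E alpha : omega1 alpha = anti_aut C (e ('i * alpha)).
Proof. by rewrite /omega1 /anti_aut !expCE expN. Qed.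

Lemma exp_i_surj (c : C) : c != 0 -> exists alpha, e ('i * alpha) = c.
Proof.
move=> /e_surj[z <-]; exists (z / 'i).
by rewrite mulrC divfK // neq0Ci.
Qed.

Lemma range_omega0 : range (@omega0 C) = diag_auts C.
Proof.
apply/seteqP; split=> [_ [a _ <-]|_ [c /= /exp_i_surj[a <-] <-]].
  by exists (e ('i * a)); [exact: exp_neq0|rewrite omega0E].
by exists a; [|rewrite omega0E].
Qed.

Lemma range_omega1 : range (@omega1 C) = anti_auts C.
Proof.
apply/seteqP; split=> [_ [a _ <-]|_ [c /= /exp_i_surj[a <-] <-]].
  by exists (e ('i * a)); [exact: exp_neq0|rewrite omega1E].
by exists a; [|rewrite omega1E].
Qed.

Lemma omega0_Ad (alpha : C) : omega0 alpha = Ad alpha.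
Proof. by rewrite omega0E AdE. Qed.

Lemma Ad_lclassE (w : 'rV[C]_4 -> 'rV[C]_4) :
  Ad_lclass w = [set f \o w | f in diag_auts C].
Proof.
by rewrite -range_omega0 image_comp; apply: eq_imagel => b _ /=;
  rewrite omega0_Ad.
Qed.

Lemma Ad_rclassE (w : 'rV[C]_4 -> 'rV[C]_4) :
  Ad_rclass w = [set w \o f | f in diag_auts C].
Proof.
by rewrite -range_omega0 image_comp; apply: eq_imagel => b _ /=;
  rewrite omega0_Ad.
Qed.

Lemma omega1_conjugate (a a' : C) :
  exists beta, is_conjugate (Ad beta) (omega1 a) (omega1 a').
Proof.
rewrite !omega1E.
have [b b0 ab] := anti_aut_conjugate _ _ _
  (exp_neq0 ('i * a)) (exp_neq0 ('i * a')).
by have [beta betaE] := exp_i_surj b b0; exists beta; rewrite AdE betaE.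
Qed.

Lemma casimir_aut_classification (k : C) :
  [/\ casimir_aut k = range (@omega0 C) `|` range (@omega1 C),
      forall alpha : C, omega0 alpha = Ad alpha,
      forall alpha alpha' : C, exists beta : C,
        is_conjugate (Ad beta) (omega1 alpha) (omega1 alpha'),
      [/\ [set Ad_lclass w | w in casimir_aut k] =
            [set Ad_lclass id; Ad_lclass (omega1 0)],
          [set Ad_rclass w | w in casimir_aut k] =
            [set Ad_rclass id; Ad_rclass (omega1 0)],
          Ad_lclass (@id 'rV[C]_4) <> Ad_lclass (omega1 0) &
          Ad_rclass (@id 'rV[C]_4) <> Ad_rclass (omega1 0)] &
      ~ exists beta : C, omega1 0 = Ad beta].
Proof.
have autE : casimir_aut k = diag_auts C `|` anti_auts C.
  apply/seteqP; split=> w.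
    by move=> /casimir_autP[[c c0 ->]|[c c0 ->]]; [left|right]; exists c.
  move=> [[c c0 <-]|[c c0 <-]]; first exact: diag_aut_casimir.
  exact: anti_aut_casimir.
have n10 := oner_neq0 C.
have e0 := exp_neq0 ('i * 0).
have id1 : @id 'rV[C]_4 = diag_aut C 1 by rewrite diag_aut1.
(* On either side, the class of any member of a family is that whole family, which leaves exactly
   two classes. *)
have ld c : c != 0 -> Ad_lclass (diag_aut C c) = diag_auts C.
  by move=> c0; rewrite Ad_lclassE; exact: diag_auts_comp_diag.
have la c : c != 0 -> Ad_lclass (anti_aut C c) = anti_auts C.
  by move=> c0; rewrite Ad_lclassE; exact: diag_auts_comp_anti.
have rd c : c != 0 -> Ad_rclass (diag_aut C c) = diag_auts C.
  by move=> c0; rewrite Ad_rclassE; exact: diag_comp_diag_auts.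
have ra c : c != 0 -> Ad_rclass (anti_aut C c) = anti_auts C.
  by move=> c0; rewrite Ad_rclassE; exact: anti_comp_diag_auts.
split.
- by rewrite range_omega0 range_omega1.
- exact: omega0_Ad.
- exact: omega1_conjugate.
- rewrite id1 omega1E (ld _ n10) (la _ e0) (rd _ n10) (ra _ e0).
  by rewrite autE; split; [exact: image_diag_anti_auts
    |exact: image_diag_anti_auts
    |exact: diag_auts_neq_anti_auts|exact: diag_auts_neq_anti_auts].
- by move=> [beta]; rewrite omega1E AdE => /esym /diag_aut_neq_anti_aut.
Qed.

End Inner.

Theorem mainTheorem1 (R : realType) (k : R[i]) (k_neq0 : k != 0) :
  [/\ casimir_aut k = range (@omega0 R[i]) `|` range (@omega1 R[i]),
      forall alpha : R[i], omega0 alpha = Ad alpha,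
      forall alpha alpha' : R[i], exists beta : R[i],
        is_conjugate (Ad beta) (omega1 alpha) (omega1 alpha'),
      [/\ [set Ad_lclass w | w in casimir_aut k] =
            [set Ad_lclass id; Ad_lclass (omega1 0)],
          [set Ad_rclass w | w in casimir_aut k] =
            [set Ad_rclass id; Ad_rclass (omega1 0)],
          Ad_lclass (@id 'rV[R[i]]_4) <> Ad_lclass (omega1 0) &
          Ad_rclass (@id 'rV[R[i]]_4) <> Ad_rclass (omega1 0)] &
      ~ exists beta : R[i], omega1 0 = Ad beta].
Proof.
exact: (casimir_aut_classification R[i] (cexp R) (cvg_exp R) (cexpD R)
  (cexp_surj R)).
Qed.
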